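(* The minimal logic of implicative $\wedge$-semilattices is sound in the class $\mathbb{S}$ of frames: if $\varphi\vdash\psi$ is provable, then $[\![\varphi]\!]_{\mathfrak{M}}\subseteq[\![\psi]\!]_{\mathfrak{M}}$ for every model $\mathfrak{M}=(\mathfrak{F},V)$ on a frame $\mathfrak{F}\in\mathbb{S}$.
   Context: Logic (integral case, the truth constant being identified with $\top$). Sentences: $\varphi::=p_i\,(i\in\mathbb{N})\mid\top\mid\varphi\wedge\varphi\mid\varphi\to\varphi$. Sequents $\varphi\vdash\psi$ are generated by: $\varphi\vdash\varphi$; $\varphi\vdash\top$; cut; uniform substitution; the two-way rule $\varphi\vdash\psi$ iff $\top\vdash\varphi\to\psi$; from $\psi\vdash\vartheta$ infer $\varphi\to\psi\vdash\varphi\to\vartheta$ and $\vartheta\to\varphi\vdash\psi\to\varphi$; from $\varphi\vdash\vartheta$ infer $\varphi\wedge\psi\vdash\vartheta$; from $\psi\vdash\vartheta$ infer $\varphi\wedge\psi\vdash\vartheta$; from $\varphi\vdash\psi$ and $\varphi\vdash\vartheta$ infer $\varphi\vdash\psi\wedge\vartheta$; and the axiom $(\varphi\to\psi)\wedge(\varphi\to\vartheta)\vdash\varphi\to(\psi\wedge\vartheta)$. Frames. $\mathfrak{F}=(W_1,W_\partial,I,T)$: $W_1,W_\partial$ nonempty sets (not necessarily disjoint), $I\subseteq W_1\times W_\partial$, $T\subseteq W_\partial\times(W_1\times W_\partial)$. Let $\perp$ be the complement of $I$. For $A\subseteq W_1$, $A'=\{y\in W_\partial\mid\forall x\in A\;x\perp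 y\}$; for $B\subseteq W_\partial$, $B'=\{x\in W_1\mid\forall y\in B\;x\perp y\}$. Galois sets are subsets $G$ of $W_1$ (stable) or $W_\partial$ (co-stable) with $G=G''$. $Txv=\{y\in W_\partial\mid yTxv\}$; the Galois dual $T'$ is given by $uT'xv$ iff $u\in(Txv)'$. $\mathbb{S}$ is the class of frames satisfying: (F1) for all $x\in W_1,v\in W_\partial$, $Txv$ is a Galois set; (F2) for all $x\in W_1,v\in W_\partial$: $x\perp v$ iff $uT'xv$ for all $u\in W_1$; (F3) for all $x,z\in W_1$ the section $\{y\in W_\partial\mid xT'zy\}$ is a Galois (co-stable) set. Models. $V$ assigns a Galois stable set $V(p_i)\subseteq W_1$ to each $p_i$. $[\![p_i]\!]=V(p_i)$, $[\![\top]\!]=W_1$, $[\![\varphi\wedge\psi]\!]=[\![\varphi]\!]\cap[\![\psi]\!]$, $[\![\varphi\to\psi]\!]=\{u\in W_1\mid\forall x\in[\![\varphi]\!]\,\forall v\in[\![\psi]\!]'\;uT'xv\}$. *)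

(* Defs.v *)
From mathcomp Require Import all_boot.
From mathcomp Require Import boolp classical_sets.

Set Implicit Arguments.
Unset Strict Implicit.
Unset Printing Implicit Defensive.

Local Open Scope classical_set_scope.

Inductive form : Type :=
| Var of nat
| Top
| And of form & form
| Imp of form & form.

Fixpoint subst (s : nat -> form) (phi : form) : form :=
  match phi with
  | Var i => s i
  | Top => Top
  | And phi psi => And (subst s phi) (subst s psi)
  | Imp phi psi => Imp (subst s phi) (subst s psi)
  end.

Inductive provable : form -> form -> Prop :=
| pr_refl phi : provable phi phi
| pr_top phi : provable phi Top
| pr_cut phi psi theta :
    provable phi psi -> provable psi theta -> provable phi theta
| pr_subst (s : nat -> form) phi psi :
    provable phi psi -> provable (subst s phi) (subst s psi)
| pr_imp_intro phi psi :
    provable phi psi -> provable Top (Imp phi psi)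
| pr_imp_elim phi psi :
    provable Top (Imp phi psi) -> provable phi psi
| pr_imp_monoR phi psi theta :
    provable psi theta -> provable (Imp phi psi) (Imp phi theta)
| pr_imp_antiL phi psi theta :
    provable psi theta -> provable (Imp theta phi) (Imp psi phi)
| pr_andL1 phi psi theta :
    provable phi theta -> provable (And phi psi) theta
| pr_andL2 phi psi theta :
    provable psi theta -> provable (And phi psi) theta
| pr_andR phi psi theta :
    provable phi psi -> provable phi theta -> provable phi (And psi theta)
| pr_imp_and phi psi theta :
    provable (And (Imp phi psi) (Imp phi theta)) (Imp phi (And psi theta)).

(* The two sorts are separate types; this loses no generality for possibly
   overlapping sets, since elements of the two sorts are never compared. *)
Record frame : Type := Frame {
  W1 : Type;
  Wd : Type;
  W1_neq0 : [set: W1] !=set0;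
  Wd_neq0 : [set: Wd] !=set0;
  relI : W1 -> Wd -> Prop;
  relT : Wd -> W1 -> Wd -> Prop   (* [relT y x v] is y T x v *)
}.

Arguments relI {f} x y.
Arguments relT {f} y x v.

Section Galois.
Variable F : frame.
Implicit Types (x u z : W1 F) (y v : Wd F).

Definition perp x y : Prop := ~ relI x y.

Definition dual1 (A : set (W1 F)) : set (Wd F) :=
  [set y | forall x, A x -> perp x y].

Definition duald (B : set (Wd F)) : set (W1 F) :=
  [set x | forall y, B y -> perp x y].

Definition stable (A : set (W1 F)) : Prop := A = duald (dual1 A).

Definition costable (B : set (Wd F)) : Prop := B = dual1 (duald B).

Definition Tsec x v : set (Wd F) := [set y | relT y x v].

Definition dualT u x v : Prop := duald (Tsec x v) u.

Definition axF1 : Prop := forall x v, costable (Tsec x v).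

Definition axF2 : Prop := forall x v, perp x v <-> forall u, dualT u x v.

Definition axF3 : Prop := forall x z, costable [set y | dualT x z y].

Definition classS : Prop := [/\ axF1, axF2 & axF3].

End Galois.

Record model (F : frame) : Type := Model {
  valuation : nat -> set (W1 F);
  valuation_stable : forall i, stable (valuation i)
}.

Fixpoint interp (F : frame) (M : model F) (phi : form) : set (W1 F) :=
  match phi with
  | Var i => valuation M i
  | Top => setT
  | And phi psi => interp M phi `&` interp M psi
  | Imp phi psi =>
      [set u | forall x, interp M phi x ->
               forall v, dual1 (interp M psi) v -> dualT u x v]
  end.

(* Main.v *)
Require Import Defs.
From mathcomp Require Import all_boot.
From mathcomp Require Import boolp classical_sets.

(** By (F2), [Top] forces [phi -> psi] exactly when [phi] is included in
    [psi''] = [psi].  For the distribution axiom, let [C] be the section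
    [{v | u T' x v}]: if [C] contains [psi'] and [theta'], then [C'] is included
    in [psi'' `&` theta'' = psi `&` theta], hence [C = C''] (F3) contains
    [(psi `&` theta)'].  Uniform substitution is absorbed by changing the
    valuation, which is legitimate because every interpretation is stable. *)

Set Implicit Arguments.
Unset Strict Implicit.
Unset Printing Implicit Defensive.

Local Open Scope classical_set_scope.

Section GaloisConnection.
Variable F : frame.
Implicit Types (A : set (W1 F)) (B : set (Wd F)).

Lemma dual1_anti A1 A2 : A1 `<=` A2 -> dual1 A2 `<=` dual1 A1.
Proof. by move=> sA y yA x /sA; exact: yA. Qed.

Lemma duald_anti B1 B2 : B1 `<=` B2 -> duald B2 `<=` duald B1.
Proof. by move=> sB x xB y /sB; exact: xB. Qed.

Lemma subset_duald_dual1 A : A `<=` duald (dual1 A).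
Proof. by move=> x Ax y; exact. Qed.

Lemma subset_dual1_duald B : B `<=` dual1 (duald B).
Proof. by move=> y By x; exact. Qed.

Lemma stable_of_subset A : duald (dual1 A) `<=` A -> stable A.
Proof. by move=> sA; apply/seteqP; split=> //; exact: subset_duald_dual1. Qed.

Lemma stable_duald B : stable (duald B).
Proof. exact/stable_of_subset/duald_anti/subset_dual1_duald. Qed.

Lemma stable_setT : stable [set: W1 F].
Proof. exact: stable_of_subset. Qed.

Lemma stableI A1 A2 : stable A1 -> stable A2 -> stable (A1 `&` A2).
Proof.
move=> sA1 sA2; apply: stable_of_subset => x xA; split.
- by rewrite sA1; apply: duald_anti xA; apply: dual1_anti => ? [].
- by rewrite sA2; apply: duald_anti xA; apply: dual1_anti => ? [].
Qed.

(** For stable sets the dual of the intersection is the co-stable closure of the union of the two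
    duals, hence the least co-stable set above both. *)
Lemma costable_dual1_setI A1 A2 B : stable A1 -> stable A2 -> costable B ->
  dual1 A1 `<=` B -> dual1 A2 `<=` B -> dual1 (A1 `&` A2) `<=` B.
Proof.
move=> sA1 sA2 cB A1B A2B; rewrite cB; apply: dual1_anti => x xB; split.
- by rewrite sA1; exact: duald_anti xB.
- by rewrite sA2; exact: duald_anti xB.
Qed.

End GaloisConnection.

Lemma stable_interp (F : frame) (M : model F) (phi : form) :
  stable (interp M phi).
Proof.
elim: phi => [i||phi sphi psi spsi|phi _ psi _] /=.
- exact: valuation_stable.
- exact: stable_setT.
- exact: stableI.
(* An implication denotes the dual of a union of sections [Tsec x v], and every dual is stable, so
   no frame axiom enters here. *)
- suff -> : [set u | forall x, interp M phi x ->
      forall v, dual1 (interp M psi) v -> dualT u x v] =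
    duald (\bigcup_(x in interp M phi) \bigcup_(v in dual1 (interp M psi))
             Tsec x v) by exact: stable_duald.
  apply/seteqP; split=> [u uT y [x px [v qv Ty]]|u uT x px v qv y Ty].
  + exact: uT px v qv y Ty.
  + by apply: uT; exists x => //; exists v.
Qed.

Definition subst_model (F : frame) (M : model F) (s : nat -> form) : model F :=
  @Model F (fun i => interp M (s i)) (fun i => stable_interp M (s i)).

Lemma interp_subst (F : frame) (M : model F) (s : nat -> form) (phi : form) :
  interp M (subst s phi) = interp (subst_model M s) phi.
Proof. by elim: phi => //= phi -> psi ->. Qed.

Lemma setT_sub_interp_Imp (F : frame) (M : model F) (phi psi : form) :
  axF2 F ->
  [set: W1 F] `<=` interp M (Imp phi psi) <-> interp M phi `<=` interp M psi.
Proof.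
move=> F2; split=> [valid x px|sub u _ x px v qv].
(* Stability of [psi] reduces membership of [x] to [perp x v] for all [v] in the dual of [psi]. *)
- rewrite (stable_interp M psi) => v qv; apply/F2 => u.
  exact: (valid u I x px v qv).
- by have /F2 : perp x v by exact/qv/sub.
Qed.

Theorem theorem5p1 (phi psi : form) (Hprov : provable phi psi)
    (F : frame) (HF : classS F) (M : model F) :
  interp M phi `<=` interp M psi.
Proof.
(* The model stays general in the induction: the substitution case needs the hypothesis at
   [subst_model M s]. *)
case: HF => _ F2 F3; elim: Hprov M => {phi psi}.
- by move=> phi M u.
- by [].
- by move=> phi psi theta _ IH1 _ IH2 M; exact: subset_trans (IH1 M) (IH2 M).
- by move=> s phi psi _ IH M; rewrite !interp_subst.
- by move=> phi psi _ IH M; apply/setT_sub_interp_Imp => //; exact: IH.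
- by move=> phi psi _ IH M; apply/setT_sub_interp_Imp => //; exact: IH.
- move=> phi psi theta _ IH M u uT x px v tv.
  by apply: uT => //; exact: dual1_anti (IH M) _ tv.
- by move=> phi psi theta _ IH M u uT x px; apply: uT; exact: IH.
- by move=> phi psi theta _ IH M u [pu _]; exact: IH.
- by move=> phi psi theta _ IH M u [_ qu]; exact: IH.
- by move=> phi psi theta _ IH1 _ IH2 M u pu; split; [exact: IH1|exact: IH2].
- move=> phi psi theta M u [upsi utheta] x px.
  (* For fixed [u] and [x], the goal is an inclusion into the section of all [v] with
     [dualT u x v]. *)
  apply: costable_dual1_setI (F3 u x) _ _; do ?exact: stable_interp.
  + exact: upsi.
  + exact: utheta.
Qed.
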